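(* Let $z_i,z_j$ be nonzero complex numbers, and let $w_z$ and $R_{\cdot,\cdot}^{\cdot,\cdot}(z_i,z_j)$ be the Boltzmann weights defined in the context. Then for every choice of decorated spins $\sigma,\tau,\theta,\rho$ and of spins $\alpha,\beta\in\{+,-\}$, $$\sum_{\nu,\mu,\gamma}R_{\sigma,\tau}^{\nu,\mu}(z_i,z_j)\,w_{z_j}(\nu,\beta,\theta,\gamma)\,w_{z_i}(\mu,\gamma,\rho,\alpha)=\sum_{\phi,\psi,\delta}w_{z_i}(\tau,\beta,\psi,\delta)\,w_{z_j}(\sigma,\delta,\phi,\alpha)\,R_{\phi,\psi}^{\theta,\rho}(z_i,z_j),$$ where $\nu,\mu,\phi,\psi$ run over all decorated spins and $\gamma,\delta$ run over $\{+,-\}$. (That is, the two systems, one with the $R$-vertex to the left of a column of two vertices with parameters $z_j$ (top), $z_i$ (bottom), the other with the $R$-vertex to the right of a column with parameters $z_i$ (top), $z_j$ (bottom), with the same boundary data, have equal partition functions.)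
   Context: Let $n\ge1$ be an integer, $v$ a fixed (complex) parameter, and $g:\mathbb Z\to\mathbb C$ a function periodic modulo $n$ with $g(0)=-v$ and $g(a)g(n-a)=v$ whenever $n\nmid a$. A *decorated spin* is one of the $n+1$ symbols $+a$ ($a\in\mathbb Z/n\mathbb Z$) or $-0$. Horizontal edges carry decorated spins; vertical edges carry spins in $\{+,-\}$. *Weights of ordinary vertices.* For $z\in\mathbb C^\times$, $w_z(l,t,r,b)$ is the weight of a vertex with left edge $l$, top edge $t$, right edge $r$, bottom edge $b$ ($l,r$ decorated spins; $t,b$ spins). The nonzero values are, for $a\in\mathbb Z/n\mathbb Z$: $w_z(+(a{+}1),+,+a,+)=1$; $w_z(-0,-,-0,-)=z$; $w_z(+(a{+}1),-,+a,-)=g(a)$; $w_z(-0,+,-0,+)=z$; $w_z(-0,+,+0,-)=(1-v)z$; $w_z(+1,-,-0,+)=1$. All other values are $0$. *Weights of the $R$-vertex.* $R_{\alpha,\beta}^{\gamma,\delta}(x,y)$ is the weight of the $R$-vertex with bottom-left edge $\alpha$, top-left edge $\beta$, top-right edge $\gamma$, bottom-right edge $\delta$ (all decorated spins). The nonzero values are, for $a,b\in\mathbb Z/n\mathbb Z$ with $a\neq b$ wherever both occur: $R_{+a,+a}^{+a,+a}=x^n-vy^n$; $R_{+b,+a}^{+b,+a}=g(a-b)(y^n-x^n)$; $R_{+b,+a}^{+a,+b}=(1-v)y^cx^{n-c}$, where $c\equiv a-b\bmod n$, $0\le c<n$; $R_{-0,-0}^{-0,-0}=y^n-vx^n$; $R_{+a,-0}^{+a,-0}=v(y^n-x^n)$;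 $R_{-0,+a}^{-0,+a}=y^n-x^n$; $R_{-0,+a}^{+a,-0}=(1-v)y^ax^{n-a}$ and $R_{+a,-0}^{-0,+a}=(1-v)y^{n-a}x^a$, where in these two the representative of $a$ mod $n$ with $1\le a\le n$ is used. All other values are $0$. *)

(* Defs.v *)
From HB Require Import structures.
From mathcomp Require Import all_boot all_order all_algebra.
From mathcomp Require Import complex.
From mathcomp Require Import reals.

Set Implicit Arguments.
Unset Strict Implicit.
Unset Printing Implicit Defensive.

Import GRing.Theory.
Local Open Scope ring_scope.
Local Open Scope complex_scope.

Variant spin := Plus | Minus.

Definition bool_of_spin (s : spin) : bool := if s is Plus then true else false.
Definition spin_of_bool (b : bool) : spin := if b then Plus else Minus.
Lemma bool_of_spinK : cancel bool_of_spin spin_of_bool.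
Proof. by case. Qed.
HB.instance Definition _ := Finite.copy spin (can_type bool_of_spinK).

(* [DPlus a] is the symbol +a and [DMinus0] the symbol -0.  Residues modulo n
   are represented by ['I_n] rather than ['Z_n], because ['Z_1] has two
   elements and the case n = 1 is allowed. *)
Variant dspin (n : nat) := DPlus of 'I_n | DMinus0.
Arguments DMinus0 {n}.

Definition option_of_dspin n (s : dspin n) : option 'I_n :=
  if s is DPlus a then Some a else None.
Definition dspin_of_option n (o : option 'I_n) : dspin n :=
  if o is Some a then DPlus a else DMinus0.
Lemma option_of_dspinK n : cancel (@option_of_dspin n) (@dspin_of_option n).
Proof. by case. Qed.
HB.instance Definition _ n := Finite.copy (dspin n) (can_type (@option_of_dspinK n)).

Section Weights.

Variables (R : realType) (n : nat) (v : R[i]) (g : int -> R[i]).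

(* Edges in the order left, top, right, bottom.  [ordS a] is a + 1 mod n. *)
Definition vertex_weight (z : R[i])
    (l : dspin n) (t : spin) (r : dspin n) (b : spin) : R[i] :=
  match l, t, r, b with
  | DPlus a', Plus, DPlus a, Plus => if a' == ordS a then 1 else 0
  | DMinus0, Minus, DMinus0, Minus => z
  | DPlus a', Minus, DPlus a, Minus => if a' == ordS a then g a%:Z else 0
  | DMinus0, Plus, DMinus0, Plus => z
  | DMinus0, Plus, DPlus a, Minus =>
      if (a == 0 %[mod n])%N then (1 - v) * z else 0
  | DPlus a, Minus, DMinus0, Plus => if (a == 1 %[mod n])%N then 1 else 0
  | _, _, _, _ => 0
  end.

(* The c with 0 <= c < n and c = a - b mod n. *)
Definition subrep (a b : 'I_n) : nat := `|((a%:Z - b%:Z) %% n%:Z)%Z|%N.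

(* The representative of a in {1, ..., n}. *)
Definition posrep (a : 'I_n) : nat := if (a : nat) == 0%N then n else a.

(* Edges in the order bottom-left, top-left, top-right, bottom-right, i.e.
   R_weight x y alpha beta gamma delta is R_{alpha,beta}^{gamma,delta}(x,y). *)
Definition R_weight (x y : R[i]) (bl tl tr br : dspin n) : R[i] :=
  match bl, tl, tr, br with
  | DPlus b, DPlus a, DPlus c, DPlus d =>
      if a == b then
        (if (c == a) && (d == a) then x ^+ n - v * y ^+ n else 0)
      else if (c == b) && (d == a) then
        g (a%:Z - b%:Z) * (y ^+ n - x ^+ n)
      else if (c == a) && (d == b) then
        (1 - v) * y ^+ subrep a b * x ^+ (n - subrep a b)
      else 0
  | DMinus0, DMinus0, DMinus0, DMinus0 => y ^+ n - v * x ^+ n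
  | DPlus a, DMinus0, DPlus c, DMinus0 =>
      if c == a then v * (y ^+ n - x ^+ n) else 0
  | DMinus0, DPlus a, DMinus0, DPlus d =>
      if d == a then y ^+ n - x ^+ n else 0
  | DMinus0, DPlus a, DPlus c, DMinus0 =>
      if c == a then (1 - v) * y ^+ posrep a * x ^+ (n - posrep a) else 0
  | DPlus a, DMinus0, DMinus0, DPlus d =>
      if d == a then (1 - v) * y ^+ (n - posrep a) * x ^+ posrep a else 0
  | _, _, _, _ => 0
  end.

End Weights.

(* Main.v *)
(* The weight R_{s,t}^{p,q} vanishes unless {p, q} = {s, t}, so each partition
   function reduces to at most two configurations of horizontal edges, summed
   over one vertical spin.  A vertex lowers the decoration of a plus by one and
   R depends only on differences of decorations, so writing the decorations on
   the left boundary as successors makes both sides sums of products of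
   indicator functions of the same equalities between residues.  Deciding these
   equalities leaves polynomial identities in [zi], [zj], [v] and values
   of [g], in which [g] enters through g(0) = -v and g(a) g(-a) = v for a <> 0. *)
Require Import Defs.
From mathcomp Require Import all_boot all_order all_algebra.
From mathcomp Require Import complex.
From mathcomp Require Import reals.
From mathcomp Require Import zify ring.

Set Implicit Arguments.
Unset Strict Implicit.
Unset Printing Implicit Defensive.

Import GRing.Theory.
Local Open Scope ring_scope.
Local Open Scope complex_scope.

Lemma sum_spin (V : nmodType) (F : spin -> V) :
  \sum_(s : spin) F s = F Plus + F Minus.
Proof.
rewrite (bigD1 Plus) //= (bigD1 Minus) //= big1 ?addr0 //.
by case.
Qed.

(** On the diagonal the two surviving pairs coincide, so the second term is dropped to avoid
    counting it twice. *)
Lemma sum_pair_swap (V : nmodType) (T : finType) (F : T -> T -> V) (s t : T) :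
  (forall p q, ~~ ((p == s) && (q == t)) -> ~~ ((p == t) && (q == s)) ->
     F p q = 0) ->
  \sum_p \sum_q F p q = F s t + (if s == t then 0 else F t s).
Proof.
move=> F0; rewrite pair_big (bigD1 (s, t)) //=; congr (_ + _).
case: (eqVneq s t) F0 => [<-|st] F0.
  by apply: big1 => -[p q] pq; apply: F0; exact: pq.
rewrite (bigD1 (t, s)) /=; last by rewrite xpair_eqE eq_sym (negPf st).
rewrite big1 ?addr0 // => -[p q] /andP[pq qp]; exact: F0.
Qed.

Lemma eq_DPlus n (a b : 'I_n) : (DPlus a == DPlus b) = (a == b).
Proof. by []. Qed.

Lemma eq_DPlus_DMinus0 n (a : 'I_n) :
  ((DPlus a == DMinus0) = false) * ((DMinus0 == DPlus a) = false).
Proof. by []. Qed.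

Lemma dspin_ordS_ind n (P : dspin n -> Prop) :
  (forall a, P (DPlus (ordS a))) -> P DMinus0 -> forall s, P s.
Proof. by move=> PS P0 [a|//]; rewrite -(ord_predK a). Qed.

Lemma eq_ordS n (a b : 'I_n) : (ordS a == ordS b) = (a == b).
Proof. exact/inj_eq/ordS_inj. Qed.

Lemma eqmod0_ord m (a : 'I_m.+1) : (a == 0 %[mod m.+1])%N = (a == ord0).
Proof. by rewrite mod0n modn_small. Qed.

Lemma eqmod1_ordS m (a : 'I_m.+1) :
  (ordS a == 1 %[mod m.+1])%N = (a == ord0).
Proof. by rewrite -(eq_ordS a) -val_eqE /= modn_mod. Qed.

(** The successor can only wrap around at [a.+1 = n], and there residue 0 is represented by n. *)
Lemma posrep_ordS n (a : 'I_n) : posrep (ordS a) = a.+1.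
Proof.
rewrite /posrep /=; have := ltn_ord a; rewrite leq_eqVlt => /predU1P[an|an].
  by rewrite an modnn eqxx.
by rewrite modn_small.
Qed.

Lemma posrep_ord0 m : posrep (ord0 : 'I_m.+1) = m.+1.
Proof. by []. Qed.

Lemma posrep_neq0 m (a : 'I_m.+1) : a != ord0 -> posrep a = a.
Proof. by rewrite /posrep -val_eqE => /negPf /= ->. Qed.

Lemma ordS_diff n (a b : 'I_n) : exists k : int,
  (ordS a)%:Z - (ordS b)%:Z = a%:Z - b%:Z + k * n%:Z.
Proof.
(* Each [ordS] removes n times the quotient of the successor by n; the witness collects both
   quotients. *)
exists ((b.+1 %/ n)%N%:Z - (a.+1 %/ n)%N%:Z) => /=.
have Ea := divn_eq a.+1 n; have Eb := divn_eq b.+1 n.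
lia.
Qed.

Lemma subrep_ordS n (a b : 'I_n) : subrep (ordS a) (ordS b) = subrep a b.
Proof. by rewrite /subrep; have [k ->] := ordS_diff a b; rewrite addrC modzMDl. Qed.

Lemma subrep_ord0r m (a : 'I_m.+1) : subrep a ord0 = a.
Proof. by rewrite /subrep subr0 modz_small ?absz_nat //= ltz_nat. Qed.

Lemma subrep_ord0l m (a : 'I_m.+1) : a != ord0 -> subrep ord0 a = (m.+1 - a)%N.
Proof.
rewrite /subrep -val_eqE -lt0n sub0r -modzDr /=; have := ltn_ord a.
move: (nat_of_ord a) => k km k0; rewrite modz_small; lia.
Qed.

Lemma dvdz_ord m (a : 'I_m.+1) : (m.+1%:Z %| a%:Z)%Z = (a == ord0).
Proof.
rewrite dvdzE !absz_nat -val_eqE /=; case: (posnP a) => [-> //|a0].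
by rewrite gtnNdvd // eqn0Ngt a0.
Qed.

Section Periodic.
Variables (T : Type) (n : nat) (g : int -> T).
Hypothesis g_periodic : forall a : int, g (a + n%:Z) = g a.

Lemma periodicMz a k : g (a + k * n%:Z) = g a.
Proof.
have H b (i : nat) : g (b + i%:Z * n%:Z) = g b.
  elim: i => [|i IH]; first by congr g; lia.
  by rewrite -IH -[RHS]g_periodic; congr g; lia.
case: k => i; first exact: H.
(* For negative [k], [H] is used from the shifted point back up to [a]. *)
by rewrite -[LHS](H _ i.+1); congr g; lia.
Qed.

Lemma periodic_ordS (a b : 'I_n) :
  g ((ordS a)%:Z - (ordS b)%:Z) = g (a%:Z - b%:Z).
Proof. by have [k ->] := ordS_diff a b; rewrite periodicMz. Qed.

End Periodic.

Lemma R_weight_supp (R : realType) n (v : R[i]) g x y (s t p q : dspin n) :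
  ~~ ((p == s) && (q == t)) -> ~~ ((p == t) && (q == s)) ->
  R_weight v g x y s t p q = 0.
Proof.
case: s => [s|]; case: t => [t|]; case: p => [p|]; case: q => [q|] //=;
  rewrite ?eq_DPlus ?andbT ?eqxx //.
- case: (eqVneq t s) => [->|ts]; first by move/negPf ->.
  by move=> /negPf -> /negPf ->.
all: by case: ifP => // /eqP ->; rewrite eqxx.
Qed.

Ltac decide_cond a b :=
  let H := fresh "H" in
  case: (eqVneq a b) => [H|H]; [subst | rewrite ?(eq_sym b a) ?(negPf H)].

Ltac decide_ifs :=
  repeat (rewrite ?eqxx /=;
    match goal with
    | |- context [if ?a == ?b then _ else _] => decide_cond a b
    | |- context [if (?a == ?b) && _ then _ else _] => decide_cond a b
    end; rewrite ?eqxx /=);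
  try match goal with H : is_true (?a != ?a) |- _ => by rewrite eqxx in H end;
  (* This is the orientation that [posrep_neq0], [subrep_ord0l] and [gN] expect. *)
  repeat match goal with
    H : is_true (ord0 != _) |- _ => rewrite eq_sym in H
  end.

Theorem theorem3p1 (R : realType) (n : nat) (hn : (1 <= n)%N)
    (v : R[i]) (g : int -> R[i])
    (g_periodic : forall a : int, g (a + n%:Z) = g a)
    (g_0 : g 0 = - v)
    (g_mul : forall a : int, ~~ (n%:Z %| a)%Z -> g a * g (n%:Z - a) = v)
    (zi zj : R[i]) (hzi : zi != 0) (hzj : zj != 0)
    (sigma tau theta rho : dspin n) (alpha beta : spin) :
  \sum_(nu : dspin n) \sum_(mu : dspin n) \sum_(gamma : spin)
      R_weight v g zi zj sigma tau nu mu
      * vertex_weight v g zj nu beta theta gamma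
      * vertex_weight v g zi mu gamma rho alpha
  = \sum_(phi : dspin n) \sum_(psi : dspin n) \sum_(delta : spin)
      vertex_weight v g zi tau beta psi delta
      * vertex_weight v g zj sigma delta phi alpha
      * R_weight v g zi zj phi psi theta rho.
Proof.
case: n hn g_periodic g_mul sigma tau theta rho => [//|m] _ gP gM s t h r.
rewrite (sum_pair_swap (s := s) (t := t)); last first.
  by move=> p q H1 H2; apply: big1 => e _; rewrite R_weight_supp // !mul0r.
(* On the right the outgoing pair of the R-vertex is fixed and its incoming pair is summed, so the
   support conditions are needed with their equalities reversed. *)
rewrite (sum_pair_swap (s := h) (t := r)); last first.
  move=> p q H1 H2; apply: big1 => e _.
  rewrite [R_weight _ _ _ _ _ _ _ _]R_weight_supp ?mulr0 //.
    by rewrite ![_ == p]eq_sym ![_ == q]eq_sym.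
  by rewrite andbC ![_ == p]eq_sym ![_ == q]eq_sym.
rewrite !sum_spin.
have gN (a : 'I_m.+1) : a != ord0 -> g a%:Z * g (- a%:Z) = v.
  rewrite -dvdz_ord => /gM <-; rewrite -(gP (- a%:Z)).
  by congr (_ * g _); rewrite addrC.
have subSnn (a : 'I_m.+1) : (m.+1 - (m.+1 - a) = a)%N.
  by rewrite subKn // ltnW.
have subSn_ord (a : 'I_m.+1) : (m.+1 - a = (m - a).+1)%N.
  by rewrite subSn // -ltnS.
elim/dspin_ordS_ind: s => [s|]; elim/dspin_ordS_ind: t => [t|];
case: h => [h|]; case: r => [r|]; case: alpha; case: beta => /=;
rewrite ?eq_DPlus ?eq_DPlus_DMinus0 ?eq_ordS ?eqmod0_ord ?eqmod1_ordS
        ?posrep_ordS ?subrep_ordS ?(periodic_ordS gP)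
        ?mulr0 ?mul0r ?addr0 ?add0r ?if_same //.
all: decide_ifs.
all: rewrite ?mulr0 ?mul0r ?addr0 ?add0r //.
all: rewrite ?posrep_ord0 ?posrep_neq0 ?subrep_ord0r ?subrep_ord0l
             ?subr0 ?sub0r ?g_0 //.
(* Exposing n and n - a as successors turns the off-by-one between [posrep] and [subrep] exponents
   into single factors that [ring] can match. *)
all: rewrite ?subSnn ?subSS ?subnn ?subn0 ?subSn_ord ?exprS ?expr0 /=.
all: try ring.
(* Here a vertex contributes g(h) and the R-vertex g(-h), one of its two decorations being 0 up to a
   common shift; their product is v. *)
all: by match goal with H : is_true (?h != ord0) |- _ => ring: (gN h H) end.
Qed.
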